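(* Let $H$ be a finite abelian group written additively with identity $0$, and let $S\subseteq H$ be an inverse closed generating subset of $H$ with $0\notin S$. Suppose that $\Gamma=Cay(H;S)$ is a $us$-Cayley graph. Then $Aut(\Gamma)=L(H)\rtimes A$, where $L(H)$ is the left regular representation of $H$ and $A=Aut(H,S)$ is the group of all automorphisms $\theta$ of the group $H$ such that $\theta(S)=S$.
   Context: All graphs are finite, undirected and simple. A subset $S$ of an additive abelian group $H$ is inverse closed if $s\in S$ implies $-s\in S$. For such $S$ with $0\notin S$, the Cayley graph $Cay(H;S)$ is the graph with vertex set $H$ in which $x,y\in H$ are adjacent if and only if $y-x\in S$. The subset $S$ has the property ''us'' (unique summation) if: for every $0\neq g\in H$, whenever $s_1,s_2,s_3,s_4\in S$ satisfy $s_1+s_2=g=s_3+s_4$, then $\{s_1,s_2\}=\{s_3,s_4\}$. (The $s_i$ need not be distinct.) The graph $Cay(H;S)$ is called a $us$-Cayley graph if $H$ is abelian and $S$ has the property ''us''. $Aut(\Gamma)$ denotes the group of graph automorphisms of $\Gamma$. The left regular representation is $L(H)=\{l_v : v\in H\}$, a subgroup of the symmetric group on $H$, where $l_v(x)=v+x$ for every $x\in H$. A group $G$ is the (internal) semidirect product $N\rtimes Q$ of subgroups $N$ and $Q$ if $N$ is normal in $G$, $NQ=G$ and $N\cap Q=\{1\}$; here $L(H)$ and $A$ are regarded as subgroups of $Aut(\Gamma)$. *)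

(* Defs.v *)
From HB Require Import structures.
From mathcomp Require Import all_boot all_order all_algebra all_fingroup.

Set Implicit Arguments.
Unset Strict Implicit.
Unset Printing Implicit Defensive.

Import GRing.Theory GroupScope.

Local Open Scope ring_scope.

(* A finite abelian group in additive notation is an H : finZmodType. MathComp
   also equips H with a finGroupType structure whose product is +%R, so that
   <<S>> is the additive subgroup generated by S and Aut [set: H] is the group
   of automorphisms of (H, +). *)

Section GraphAut.
Variables (T : finType) (e : rel T).

Definition graph_aut : {set {perm T}} :=
  [set p : {perm T} | [forall x, forall y, e (p x) (p y) == e x y]].

Lemma graph_autP (p : {perm T}) :
  reflect (forall x y, e (p x) (p y) = e x y) (p \in graph_aut).
Proof.
rewrite inE; apply: (iffP forallP) => [h x y | h x].
  by apply/eqP; have /forallP := h x; apply.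
by apply/forallP=> y; apply/eqP.
Qed.

Lemma graph_aut_group_set : group_set graph_aut.
Proof.
apply/group_setP; split=> [|p q /graph_autP hp /graph_autP hq].
  by apply/graph_autP=> x y; rewrite !perm1.
by apply/graph_autP=> x y; rewrite !permM hq hp.
Qed.
Canonical graph_aut_group := Group graph_aut_group_set.

End GraphAut.

Section Cayley.
Variable H : finZmodType.
Implicit Types S : {set H}.

Definition Cay S : rel H := [rel x y | y - x \in S].

Definition us S : Prop :=
  forall g : H, g != 0 ->
  forall s1 s2 s3 s4 : H, s1 \in S -> s2 \in S -> s3 \in S -> s4 \in S ->
  s1 + s2 = g -> s3 + s4 = g -> [set s1; s2] = [set s3; s4].

Lemma Cay_sym S : {in S, forall s, - s \in S} -> symmetric (Cay S).
Proof.
by move=> hS x y; apply/idP/idP; rewrite /Cay /= => /hS; rewrite opprB.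
Qed.

Lemma Cay_irr S : 0 \notin S -> irreflexive (Cay S).
Proof. by move=> h x; rewrite /Cay /= subrr; apply: negbTE. Qed.

Definition ltrans (v : H) : {perm H} := perm (@addrI H v).

Definition left_reg : {set {perm H}} := [set ltrans v | v : H].

Lemma left_reg_group_set : group_set left_reg.
Proof.
apply/group_setP; split=> [|_ _ /imsetP[u _ ->] /imsetP[v _ ->]].
  by apply/imsetP; exists 0 => //; apply/permP=> x; rewrite perm1 permE add0r.
apply/imsetP; exists (v + u) => //.
by apply/permP=> x; rewrite permM !permE addrA.
Qed.
Canonical left_reg_group := Group left_reg_group_set.

Definition Aut_stab S : {set {perm H}} :=
  [set theta in Aut [set: H] | theta @: S == S].

Lemma Aut_stabP S (theta : {perm H}) :
  reflect ({morph theta : x y / x + y} /\ theta @: S = S)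
          (theta \in Aut_stab S).
Proof.
rewrite !inE; apply: (iffP andP) => [[/andP[_ /morphicP hm] /eqP] | [hm /eqP]].
  by split=> // x y; apply: hm; rewrite inE.
split=> //; apply/andP; split; first by apply/subsetP=> x; rewrite inE.
by apply/morphicP=> x y _ _; apply: hm.
Qed.

Lemma Aut_stab_group_set S : group_set (Aut_stab S).
Proof.
apply/group_setP; split=> [|p q /Aut_stabP[hp Sp] /Aut_stabP[hq Sq]].
  apply/Aut_stabP; split=> [x y|]; first by rewrite !perm1.
  by rewrite (eq_imset _ (@perm1 H)) imset_id.
apply/Aut_stabP; split=> [x y|]; first by rewrite !permM hp hq.
by rewrite (eq_imset _ (permM p q)) imset_comp Sp Sq.
Qed.
Canonical Aut_stab_group S := Group (Aut_stab_group_set S).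

End Cayley.

(* Main.v *)
(** Put f_x(s) = f(x + s) - f(x) for a graph automorphism f.  Unique summation
    forces f(x + s + t) = f(x + s) + f(x + t) - f(x) for s, t in S with
    s + t != 0, i.e. f_(x+t) and f_x agree on S except perhaps at -t.  Both are
    permutations of S, so they agree at -t as well; since S generates H, f_x
    does not depend on x on S, and f is additive as soon as f(0) = 0.  Every
    automorphism is a translation composed with one that fixes 0. *)

Require Import Defs.
From mathcomp Require Import all_boot all_order all_algebra all_fingroup.

Import GroupScope GRing.Theory.
Local Open Scope ring_scope.

(** In a finite group every element of the subgroup generated by [S] is a sum of elements of [S],
    with no inverses, so adding one generator at a time suffices. *)
Lemma gen_add_ind {H : finZmodType} {S : {set H}} {P : H -> Prop} :
  <<S>>%g = [set: H] -> P 0 ->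
  (forall y s, s \in S -> P y -> P (y + s)) -> forall y, P y.
Proof.
move=> S_gen P0 PD y; have: y \in <<S>>%g by rewrite S_gen inE.
case/gen_prodgP=> n [c cS ->]; elim: n c cS => [|n IHn] c cS.
  by rewrite big_ord0.
by rewrite big_ord_recr; apply: PD (cS _) (IHn _ _) => i; apply: cS.
Qed.

Section UniqueSummation.
Variables (H : finZmodType) (S : {set H}).
Hypothesis S_us : us S.

Lemma us_pair (a b c d : H) : a \in S -> b \in S -> c \in S -> d \in S ->
  a + b = c + d -> a + b != 0 -> a = c \/ a = d.
Proof.
move=> aS bS cS dS eq_sum nz.
have := S_us _ nz _ _ _ _ aS bS cS dS erefl (esym eq_sum).
by move/setP/(_ a); rewrite !inE eqxx => /esym/orP[]/eqP; [left | right].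
Qed.

Section Automorphism.
Variable f : {perm H}.
Hypothesis f_aut : f \in graph_aut (Cay S).

Lemma Cay_aut_diff x y : (f y - f x \in S) = (y - x \in S).
Proof. exact: (graph_autP _ _ f_aut x y). Qed.

Lemma Cay_aut_diffD x s : (f (x + s) - f x \in S) = (s \in S).
Proof. by rewrite Cay_aut_diff addrC addKr. Qed.

(** The paths from [x] to [x + s + t] through [x + s] and [x + t] have images that split one nonzero
    difference into two elements of [S] each. Injectivity of [f] forbids equal first steps when [s]
    and [t] differ, so the steps match crosswise. *)
Lemma Cay_aut_parallelogram x s t : s \in S -> t \in S -> s + t != 0 ->
  f (x + t + s) - f (x + t) = f (x + s) - f x.
Proof.
move=> sS tS nz.
set y := x + t + s.
have yE : y = x + s + t by rewrite /y addrAC.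
have yBx : y - x = s + t by rewrite yE -[x + s + t]addrA [x + _]addrC addrK.
have aS : f (x + s) - f x \in S by rewrite Cay_aut_diffD.
have bS : f (x + t) - f x \in S by rewrite Cay_aut_diffD.
have cS : f y - f (x + s) \in S by rewrite yE Cay_aut_diffD.
have dS : f y - f (x + t) \in S by rewrite Cay_aut_diffD.
have sumE u : f u - f x + (f y - f u) = f y - f x by rewrite addrC addrA subrK.
have fnz : f y - f x != 0.
  by rewrite subr_eq0 (inj_eq perm_inj) -subr_eq0 yBx.
have [eq_st | ne_st] := eqVneq s t; last first.
  have [||| //] := us_pair _ _ _ _ aS cS bS dS; rewrite ?sumE //.
  move/addIr/perm_inj/addrI => e; by rewrite e eqxx in ne_st.
(* For s = t the witnesses above coincide; instead the parallelogram is
   completed in the image and pulled back by f^-1. *)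
pose z := (f^-1)%g (f x + (f y - f (x + t))).
have fz : f z = f x + (f y - f (x + t)) by rewrite permKV.
have zxS : z - x \in S by rewrite -Cay_aut_diff fz addrC addKr.
have yzS : y - z \in S.
  suff e : f y - f z = f (x + t) - f x by rewrite -Cay_aut_diff e.
  by rewrite fz !opprD opprK addrCA addNKr addrC.
have e : z - x + (y - z) = s + t.
  by rewrite addrC addrA subrK.
have zs : z = x + s.
  (* Since [s = t], both alternatives of [us_pair] give [z - x = s]. *)
  have := us_pair _ _ _ _ zxS yzS sS tS e; rewrite e -eq_st => h.
  rewrite eq_st in nz h *; case: (h nz) => <-; by rewrite addrC subrK.
by rewrite -zs fz [f x + _]addrC addrK.
Qed.

Lemma Cay_aut_local_step x s t : s \in S -> t \in S ->
  f (x + t + s) - f (x + t) = f (x + s) - f x.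
Proof.
move=> sS tS; have [st0 | nz] := eqVneq (s + t) 0; last first.
  exact: Cay_aut_parallelogram.
(* Let u in S be the preimage of f_(x+t)(s) under f_x; if u != s = -t, then
   f_(x+t)(u) = f_x(u) = f_(x+t)(s), contradicting injectivity. *)
set d := f (x + t + s) - f (x + t).
pose u := (f^-1)%g (f x + d) - x.
have fu : f (x + u) - f x = d.
  by rewrite /u [x + _]addrC subrK permKV [f x + _]addrC addrK.
have uS : u \in S by rewrite -(Cay_aut_diffD x) fu Cay_aut_diffD.
have [<- // | ne_us] := eqVneq u s.
have nz : u + t != 0 by rewrite -st0 (inj_eq (addIr t)).
have := Cay_aut_parallelogram x _ _ uS tS nz.
rewrite fu => /addIr/perm_inj/addrI e; by rewrite e eqxx in ne_us.
Qed.

Lemma Cay_aut_additive : <<S>>%g = [set: H] -> f 0 = 0 ->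
  {morph f : x y / x + y}.
Proof.
move=> S_gen f0.
have fD y s : s \in S -> f (y + s) = f y + f s.
  move=> sS; suff: f (y + s) - f y = f s by move=> <-; rewrite [RHS]addrC subrK.
  (* The induction moves the base point [y] away from [0] along generators. *)
  move: y; apply: (gen_add_ind S_gen) => [|y t tS <-].
    by rewrite add0r f0 subr0.
  exact: Cay_aut_local_step.
move=> x y; move: y; apply: (gen_add_ind S_gen) => [|y s sS IHy].
  by rewrite f0 !addr0.
by rewrite addrA (fD (x + y) _ sS) (fD y _ sS) IHy addrA.
Qed.

End Automorphism.
End UniqueSummation.

Lemma ltransE {H : finZmodType} (v x : H) : ltrans v x = v + x.
Proof. exact: permE. Qed.

Lemma left_reg_sub_aut {H : finZmodType} (S : {set H}) :
  left_reg H \subset graph_aut (Cay S).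
Proof.
apply/subsetP=> _ /imsetP[v _ ->]; apply/graph_autP=> x y.
by rewrite /Cay /= !ltransE opprD addrACA addrN add0r.
Qed.

Lemma Aut_stab_sub_aut {H : finZmodType} (S : {set H}) :
  Aut_stab S \subset graph_aut (Cay S).
Proof.
apply/subsetP=> p /Aut_stabP[pD pS]; apply/graph_autP=> x y.
have e : p y - p x = p (y - x) by apply: (addIr (p x)); rewrite -pD !subrK.
by rewrite /Cay /= e -{1}pS (mem_imset _ _ perm_inj).
Qed.

Lemma Aut_stab0 {H : finZmodType} {S : {set H}} (p : {perm H}) :
  p \in Aut_stab S -> p 0 = 0.
Proof. by case/Aut_stabP=> pD _; apply: (addrI (p 0)); rewrite -pD !addr0. Qed.

Theorem theorem3p2 (H : finZmodType) (S : {set H})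
  (S_inv : {in S, forall s, - s \in S})
  (S_gen : <<S>>%g = [set: H])
  (S_0 : 0 \notin S)
  (S_us : us S) :
  (left_reg H ><| Aut_stab S)%g = graph_aut (Cay S).
Proof.
rewrite sdprodE.
- apply/eqP; rewrite eqEsubset mul_subG ?left_reg_sub_aut ?Aut_stab_sub_aut //.
  apply/subsetP=> p p_aut.
  (* Products of permutations act left to right: m * p sends 0 to p (m 0). *)
  pose m := ltrans ((p^-1)%g 0).
  have mL : m \in left_reg H by apply: imset_f.
  have q_aut : (m * p)%g \in graph_aut (Cay S).
    by rewrite groupM // (subsetP (left_reg_sub_aut S)).
  have q0 : (m * p)%g 0 = 0 by rewrite permM ltransE addr0 permKV.
  rewrite -(mulKg m p) mem_mulg ?groupV //.
  apply/Aut_stabP; split.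
    exact: (Cay_aut_additive _ _ S_us _ q_aut S_gen q0).
  (* By injectivity and finiteness, mapping [S] into itself is enough. *)
  apply/eqP; rewrite eqEcard card_imset ?leqnn ?andbT; last exact: perm_inj.
  apply/subsetP=> _ /imsetP[s sS ->].
  by have := Cay_aut_diffD _ _ _ q_aut 0 s; rewrite q0 add0r subr0 sS.
- apply/subsetP=> p /[dup] pA /Aut_stabP[pD _]; rewrite inE.
  apply/subsetP=> _ /imsetP[_ /imsetP[v _ ->] ->].
  (* Conjugating the translation by [v] with the additive map [p] yields the translation by
     [p v]. *)
  apply/imsetP; exists (p v) => //; apply/permP=> x.
  by rewrite !permM !ltransE pD permKV.
(* A translation that fixes [0] is the identity. *)
- apply/trivgP/subsetP=> _ /setIP[/imsetP[v _ ->] /Aut_stab0].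
  rewrite ltransE addr0 => ->; rewrite inE; apply/eqP/permP=> x.
  by rewrite ltransE perm1 add0r.
Qed.
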